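(* If a countable group $G$ has the Chatterji–Ruane (CR) property, then $G$ satisfies the centroid property.
   Context: All polynomials are assumed to have non-negative coefficients. CR property: $G$ has the CR property if $G$ acts freely by isometries on a metric space $(X,\mathrm{dist})$ such that there is a $G$-equivariant map $C\colon X\times X\to\mathcal{P}(X)$ (where $\mathcal{P}(X)$ is the set of all subsets of $X$) satisfying, for all $x,y,z\in X$: (i) $x\in C(x,y)$; (ii) $C(x,y)\cap C(y,z)\cap C(z,x)\neq\emptyset$; (iii) there is a polynomial $R$ (independent of $x,y$) such that for any $r\ge 0$ the cardinality of $C(x,y)\cap B(x,r)$ is at most $R(r)$, where $B(x,r)$ is the ball of radius $r$ centered at $x$ in $X$; (iv) there is a polynomial $Q$ (independent of $x,y$) such that if $\mathrm{dist}(x,y)\le r$, then the diameter of $C(x,y)$ is at most $Q(r)$. Centroid property: a countable group $G$ satisfies the centroid property if there exist an action of $G$ by isometries on a metric space $(X,\mathrm{dist})$ with point stabilizers finite of uniformly bounded sizes, a point $x_0\in X$, a map $\mathfrak{c}\colon G\times G\to X$ and a polynomial $P$ such that, with $L(g)=\mathrm{dist}(x_0,g\cdot x_0)$: ($c_1$) for every $k\in G$ and every $r>0$, the set $\{\mathfrak{c}(g,k): g\in G,\ L(g)\le r\}$ has at most $P(r)$ elements; ($c_2$) for every $g\in G$, the set $\{\mathfrak{c}(g,k): k\in G\}$ has at most $P(L(g))$ elements; ($c_3$) for every $h\in G$ and every $r>0$, the set $\{g^{-1}\cdot\mathfrak{c}(g,gh): g\in G,\ L(g)\le r\}$ has at most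 $P(r)$ elements. *)

(* Defs.v *)
From mathcomp Require Import all_boot all_order all_algebra.
From mathcomp Require Import all_classical all_reals all_analysis.

Set Implicit Arguments.
Unset Strict Implicit.
Unset Printing Implicit Defensive.

Import Order.TTheory GRing.Theory Num.Theory.
Local Open Scope classical_set_scope.
Local Open Scope card_scope.
Local Open Scope ring_scope.

Definition nonneg_poly (R : realType) (p : {poly R}) : Prop :=
  p \is a polyOver Num.nneg.

(* [A] is finite and its number of elements is at most the real number [b]. *)
Definition at_most (R : realType) (T : Type) (A : set T) (b : R) : Prop :=
  exists2 n : nat, A #<= `I_n & n%:R <= b.

Definition mcball (R : realType) (X : metricType R) (x : X) (r : R) : set X :=
  [set y | mdist x y <= r].

Definition diam_le (R : realType) (X : metricType R) (A : set X) (b : R) :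
    Prop :=
  forall p q : X, A p -> A q -> mdist p q <= b.

(* The actions of fingroup.action require a finite acting group, whereas [G]
   is an arbitrary group here. *)
Definition isometric_action (R : realType) (G : groupType) (X : metricType R)
    (act : G -> X -> X) : Prop :=
  [/\ forall x, act 1%g x = x,
      forall g h x, act (g * h)%g x = act g (act h x) &
      forall g x y, mdist (act g x) (act g y) = mdist x y].

Definition stabilizer (G : groupType) (X : Type) (act : G -> X -> X) (x : X) :
    set G :=
  [set g | act g x = x].

Definition free_action (G : groupType) (X : Type) (act : G -> X -> X) : Prop :=
  forall x, stabilizer act x = [set 1%g].

Definition equivariant (G : groupType) (X : Type) (act : G -> X -> X)
    (C : X -> X -> set X) : Prop :=
  forall g x y, C (act g x) (act g y) = act g @` C x y.

(* A metric space is understood to be nonempty: every group acts freely on the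
   empty space, where the remaining conditions are void. *)
Definition CR_property (R : realType) (G : groupType) : Prop :=
  exists (X : metricType R) (act : G -> X -> X) (C : X -> X -> set X),
    [/\ [set: X] !=set0, isometric_action act, free_action act &
        equivariant act C] /\
    [/\ forall x y, C x y x,
        forall x y z, C x y `&` C y z `&` C z x !=set0,
        exists2 p : {poly R}, nonneg_poly p &
          forall x y (r : R), 0 <= r -> at_most (C x y `&` mcball x r) p.[r] &
        exists2 q : {poly R}, nonneg_poly q &
          forall x y (r : R), mdist x y <= r -> diam_le (C x y) q.[r]].

Definition orbit_length (R : realType) (G : groupType) (X : metricType R)
    (act : G -> X -> X) (x0 : X) (g : G) : R :=
  mdist x0 (act g x0).

Definition centroid_property (R : realType) (G : groupType) : Prop :=
  exists (X : metricType R) (act : G -> X -> X) (x0 : X) (c : G -> G -> X)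
      (p : {poly R}),
    let L := orbit_length act x0 in
    [/\ isometric_action act,
        exists N : nat, forall x, stabilizer act x #<= `I_N &
        nonneg_poly p] /\
    [/\ forall k (r : R), 0 < r ->
          at_most [set c g k | g in [set g | L g <= r]] p.[r],
        forall g, at_most [set c g k | k in [set: G]] p.[L g] &
        forall h (r : R), 0 < r ->
          at_most [set act g^-1%g (c g (g * h)%g) | g in [set g | L g <= r]]
            p.[r]].

(* Main.v *)
Require Import Defs.
From mathcomp Require Import all_boot all_order all_algebra.
From mathcomp Require Import all_classical all_reals all_analysis.
From mathcomp Require Import ring lra.

(** The natural candidate for the centroid [c(g,k)] is a point common to
intervals [C] between [x0], [g x0] and [k x0]. The map [C] need not be
symmetric, and this is the whole difficulty: the common point lies in a cyclic
product of intervals, say [C(x0,kx0)], [C(kx0,gx0)], [C(gx0,x0)]. For fixed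
[k], few values arise near [x0] because of the interval [C(x0,kx0)], which is
thin near its origin [x0]; the symmetric count near [g x0] would need
[C(gx0,kx0)], but only the reversed interval is available, and the part of
[C(y,x)] near [x] is bounded by a polynomial in the distance of [x] and [y],
not in the radius. What remains usable is that [C(x,y)] has at most [V(d)]
elements and stays within [q(d)] of [x] when [x], [y] are at distance at most
[d], for a polynomial [V].

Reduction. It suffices to select, without any equivariance, a point [n(a,b)] in
[C(a,b)] or [C(b,a)] for all [a], [b] of the orbit, such that for each [a] the
points [n(a,b)], and the points [n(b,a)], with [b] at distance at most [r] from
[a] take polynomially many values in [r]: then [c(g,k) = k n(k^-1, k^-1 g)] is
a centroid map. By compactness (an ultrafilter on the finite subsets,
[selection_limit]) and by treating each integral scale [r] separately
([multiscale_selection]), it is enough to select on every finite set [A] at one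
scale [r], with a bound that is polynomial in [r] and does not depend on [A]
([finite_selection]).

Duality. A selection with small rows is obtained by rounding a fractional one
([selection_of_fractional]), and a minimax argument ([concave_alternative],
[fractional_selection]) shows that a fractional one exists unless there are
vertex weights [w] and symmetric edge weights [T] on the pairs at distance at
most [r] with [sum T] larger than [G sum w], whose restriction to the pairs
having a given point in their interval has norm at most [1] in l2([w]), for
every point. So the statement becomes an estimate: such a [T] has norm at most
[G] for some [G] polynomial in [r].

Norm localisation. On a ball of radius [N] with centre [z] the norm of [T] is
at most [2 V(N)], because the centroids of the triples ([a], [z], [b])
distribute the pairs [(a,b)] over few points ([local_bound_base]). To pass from
radius [N] to a much larger [N'], apply the same distribution to the power
[T^n]: a walk of length [n] from [a] to [b] stays in a ball of radius [N],
polynomial in [n r], about the centroid of ([a], [z], [b]), so the norm of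
[T^n] on the large ball is at most [V(N')] times the [n]-th power of the norm
on the small balls ([iter_op_ball_le]). The loss for [T] is thus only
[V(N')^(1/n)]. With [n = 2^i] and radii growing by a bounded factor at each
step, the product of all the losses converges and is polynomial in [r]
([form_le_global]). *)

Set Implicit Arguments.
Unset Strict Implicit.
Unset Printing Implicit Defensive.

Import Order.TTheory GRing.Theory Num.Theory.
Local Open Scope classical_set_scope.
Local Open Scope card_scope.
Local Open Scope ring_scope.

(** * A finite minimax alternative *)

Lemma sqr_negpart_add (R : realDomainType) (u h : R) :
  Num.max (- (u + h)) 0 ^+ 2 <=
    Num.max (- u) 0 ^+ 2 - 2 * (Num.max (- u) 0 * h) + h ^+ 2.
Proof.
by case: (lerP (- u) 0) => hu; case: (lerP (- (u + h)) 0) => huh; nra.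
Qed.

(** A minimax theorem for finitely many concave payoffs. The separating weights
are the negative parts of the payoffs at a near-minimiser of the sum of their
squares: moving from it towards any other [a'] cannot decrease that sum much,
which to first order says that the weighted payoff of [a'] is negative. Working
with near-minimisers avoids any compactness of [K], at the price of [eps]. *)
Lemma concave_alternative (R : realType) (I : finType) (K : Type) (a0 : K)
    (s : K -> I -> R) (bnd eps : R) :
  (forall a i, `|s a i| <= bnd) ->
  (forall a a' (t : R), 0 <= t <= 1 ->
     exists a'', forall i, (1 - t) * s a i + t * s a' i <= s a'' i) ->
  0 < eps ->
  (exists a, forall i, - eps <= s a i) \/
  (exists2 l : I -> R, forall i, 0 <= l i &
     forall a, \sum_i l i * s a i < 0).
Proof.
move=> sbnd sconc eps0.
pose neg (x : R) := Num.max (- x) 0.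
pose phi a := \sum_i neg (s a i) ^+ 2.
have neg_ge0 x : 0 <= neg x by rewrite /neg le_max lexx orbT.
have neg_sqr_le a i : neg (s a i) ^+ 2 <= phi a.
  by rewrite /phi (bigD1 i)//= lerDl sumr_ge0// => j _; rewrite sqr_ge0.
have [[a phia]|phi_big] := pselect (exists a, phi a <= eps ^+ 2).
  left; exists a => i.
  have : neg (s a i) <= eps.
    rewrite -(@ler_pXn2r _ 2)// ?nnegrE ?(ltW eps0)//.
    exact: le_trans (neg_sqr_le a i) phia.
  by rewrite /neg ge_max => /andP[]; rewrite lerNl.
right.
pose E := [set phi a | a in [set: K]].
have Einf : has_inf E.
  split; first by exists (phi a0), a0.
  by exists 0 => _ [a _ <-]; rewrite sumr_ge0// => i _; rewrite sqr_ge0.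
set m := inf E.
have m_le a : m <= phi a by apply: ge_inf => //; [exact: Einf.2 | exists a].
have m_gt0 : 0 < m.
  apply: lt_le_trans (_ : eps ^+ 2 <= m); first by rewrite exprn_gt0.
  apply: lb_le_inf => [|_ [a _ <-]]; first exact: Einf.1.
  by rewrite leNgt; apply/negP => /ltW ?; apply: phi_big; exists a.
(* [H] bounds the second order term of a step of length [t]. *)
pose H : R := \sum_(i : I) (2 * bnd) ^+ 2.
have H_ge0 : 0 <= H by rewrite sumr_ge0// => i _; rewrite sqr_ge0.
pose t := m / (H + m).
have Hm0 : 0 < H + m by rewrite ltr_wpDl.
have t_gt0 : 0 < t by rewrite divr_gt0.
have t_le1 : t <= 1 by rewrite ler_pdivrMr// mul1r lerDr.
have tH : t * H <= m.
  by rewrite /t mulrAC ler_pdivrMr// ler_pM2l// lerDl ltW.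
have [_ [a _ <-] phia] : exists2 x, E x & x < m + t * m / 2.
  by apply: inf_adherent => //; rewrite divr_gt0// mulr_gt0.
exists (fun i => neg (s a i)) => [//|a'].
have [|a'' ha''] := sconc a a' t; first by rewrite (ltW t_gt0).
have : phi a'' <= phi a - 2 * t * (\sum_i neg (s a i) * s a' i + phi a)
                 + t ^+ 2 * H.
  rewrite /phi /H -big_split/= !mulr_sumr -sumrB -big_split/=.
  apply: ler_sum => i _.
  set x := s a i; set x' := s a' i.
  have negN y : neg y * y = - neg y ^+ 2.
    rewrite /neg; case: (lerP (- y) 0) => _; last by ring.
    by rewrite expr0n/= mul0r oppr0.
  apply: le_trans (_ : neg (x + t * (x' - x)) ^+ 2 <= _).
    rewrite ler_sqr ?nnegrE// /neg.
    have := ha'' i; rewrite -/x -/x' => hx.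
    rewrite ge_max !le_max lexx orbT andbT.
    by apply/orP; left; rewrite lerN2; lra.
  apply: le_trans (sqr_negpart_add _ _) _; rewrite -/(neg x).
  have -> : neg x * (t * (x' - x)) = t * (neg x * x' + neg x ^+ 2).
    by have := negN x => e; rewrite mulrCA mulrBr e opprK.
  have hd : (x' - x) ^+ 2 <= (2 * bnd) ^+ 2.
    have := sbnd a i; have := sbnd a' i; rewrite -/x -/x' !ler_norml.
    by move=> /andP[? ?] /andP[? ?]; nra.
  rewrite exprMn.
  have := ler_wpM2l (sqr_ge0 t) hd; lra.
move=> /(le_trans (m_le a'')); have := m_le a.
set X := \sum_i _ => *.
suff : t * X < 0 by rewrite pmulr_rlt0.
have ttH : t ^+ 2 * H <= t * m by rewrite expr2 -mulrA ler_pM2l.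
have : t * m <= t * phi a by rewrite ler_pM2l.
have : 0 < t * m by rewrite mulr_gt0.
lra.
Qed.

(** * Symmetric nonnegative kernels on a weighted finite set *)

Section WeightedOperators.
Context (R : realType) (A : finType) (w : A -> R).
Hypothesis w_gt0 : forall p, 0 < w p.
Implicit Types (u v : A -> R) (T : A -> A -> R) (L : R).

Definition ip u v : R := \sum_p w p * (u p * v p).

(** The operator of l2([w]) whose quadratic form is [form T]: division by [w]
makes it self-adjoint for [ip]. *)
Definition op T v : A -> R := fun p => (\sum_q T p q * v q) / w p.

Definition form T u v : R := \sum_p \sum_q T p q * (u p * v q).

(** Nonnegative vectors suffice to bound the norm of a nonnegative kernel, and
they are the only ones for which the estimates below are available. *)
Definition form_le T L : Prop :=
  forall u, (forall p, 0 <= u p) -> form T u u <= L * ip u u.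

Definition kernel_ge0 T : Prop := forall p q, 0 <= T p q.
Definition kernel_sym T : Prop := forall p q, T p q = T q p.

Lemma ip_ge0 u : 0 <= ip u u.
Proof.
by apply: sumr_ge0 => p _; rewrite mulr_ge0 ?(ltW (w_gt0 _))// -expr2 sqr_ge0.
Qed.

(** Optimising [c] gives the Cauchy-Schwarz inequality, without square roots.
*)
Lemma ip_amgm u v (c : R) : 0 < c ->
  2 * ip u v <= c * ip u u + c^-1 * ip v v.
Proof.
move=> c0; rewrite /ip !mulr_sumr -big_split/=; apply: ler_sum => p _.
have -> : c * (w p * (u p * u p)) + c^-1 * (w p * (v p * v p)) =
  2 * (w p * (u p * v p)) + w p * c^-1 * (c * u p - v p) ^+ 2.
  by field; rewrite gt_eqF.
by rewrite lerDl mulr_ge0 ?sqr_ge0// mulr_ge0 ?invr_ge0 ?ltW.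
Qed.

Lemma ip_op T u v : ip u (op T v) = form T u v.
Proof.
rewrite /ip /form /op; apply: eq_bigr => p _.
have -> : w p * (u p * ((\sum_q T p q * v q) / w p)) = u p * \sum_q T p q * v q.
  by field; rewrite gt_eqF.
by rewrite mulr_sumr; apply: eq_bigr => q _; ring.
Qed.

Lemma form_sym T u v : kernel_sym T -> form T u v = form T v u.
Proof.
move=> Ts; rewrite /form exchange_big/=; apply: eq_bigr => q _.
by apply: eq_bigr => p _; rewrite Ts (mulrC (u p)).
Qed.

(** Polarisation. The vector [u - v] is signed, but replacing it by its
absolute value only increases [|form T d d|], so the bound on nonnegative
vectors is enough, and no constant is lost. *)
Lemma form_le_bilinear T L u v : kernel_ge0 T -> kernel_sym T -> form_le T L ->
  (forall p, 0 <= u p) -> (forall p, 0 <= v p) ->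
  2 * form T u v <= L * (ip u u + ip v v).
Proof.
move=> T0 Ts TL u0 v0.
pose s p := u p + v p; pose d p := `|u p - v p|.
have hs : form T s s <= L * ip s s by apply: TL => p; rewrite addr_ge0.
have hd : form T d d <= L * ip d d by apply: TL => p; rewrite normr_ge0.
have es : form T s s = form T u u + form T u v + (form T v u + form T v v).
  rewrite /form -!big_split/=; apply: eq_bigr => p _.
  by rewrite -!big_split/=; apply: eq_bigr => q _; rewrite /s; ring.
have ed : form T u v - form T u u + (form T v u - form T v v) <= form T d d.
  rewrite /form -!sumrB -big_split/=; apply: ler_sum => p _.
  rewrite -!sumrB -big_split/=; apply: ler_sum => q _.
  have -> : T p q * (u p * v q) - T p q * (u p * u q) +
    (T p q * (v p * u q) - T p q * (v p * v q)) =
    T p q * - ((u p - v p) * (u q - v q)) by ring.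
  by rewrite ler_wpM2l// /d -normrM -normrN ler_norm.
have ei : ip s s + ip d d = 2 * (ip u u + ip v v).
  rewrite /ip -!big_split/= mulr_sumr; apply: eq_bigr => p _.
  by rewrite /s /d -normrM -expr2 ger0_norm ?sqr_ge0//; ring.
have := form_sym v u Ts; have := congr1 ( *%R L) ei; lra.
Qed.

Lemma op_ge0 T v : kernel_ge0 T -> (forall p, 0 <= v p) ->
  forall p, 0 <= op T v p.
Proof.
move=> T0 v0 p; rewrite divr_ge0 ?(ltW (w_gt0 _))//.
by apply: sumr_ge0 => q _; rewrite mulr_ge0.
Qed.

Lemma iter_op_ge0 T v n : kernel_ge0 T -> (forall p, 0 <= v p) ->
  forall p, 0 <= iter n (op T) v p.
Proof. by move=> T0 v0; elim: n => //= n IH; apply: op_ge0. Qed.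

Lemma op_norm_le T L v : kernel_ge0 T -> kernel_sym T -> form_le T L -> 0 < L ->
  (forall p, 0 <= v p) -> ip (op T v) (op T v) <= L ^+ 2 * ip v v.
Proof.
move=> T0 Ts TL L0 v0.
(* The extremal test vector in the bilinear bound. *)
pose u p := L^-1 * op T v p.
have u0 p : 0 <= u p by rewrite mulr_ge0 ?invr_ge0 ?(ltW L0)// op_ge0.
have := form_le_bilinear T0 Ts TL u0 v0.
have euu : ip u u = L^-1 ^+ 2 * ip (op T v) (op T v).
  by rewrite /ip mulr_sumr; apply: eq_bigr => p _; rewrite /u; ring.
have euv : form T u v = L^-1 * ip (op T v) (op T v).
  by rewrite -ip_op /ip mulr_sumr; apply: eq_bigr => p _; rewrite /u; ring.
rewrite euu euv => h.
have Ln0 : L != 0 by rewrite gt_eqF.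
have := ler_wpM2l (ltW L0) h.
have -> : L * (2 * (L^-1 * ip (op T v) (op T v))) = 2 * ip (op T v) (op T v).
  by field.
have -> : L * (L * (L^-1 ^+ 2 * ip (op T v) (op T v) + ip v v)) =
  ip (op T v) (op T v) + L ^+ 2 * ip v v by field.
lra.
Qed.

Lemma iter_op_form_le T L n u v : kernel_ge0 T -> kernel_sym T ->
  form_le T L -> 0 < L ->
  (forall p, 0 <= u p) -> (forall p, 0 <= v p) ->
  2 * ip u (iter n (op T) v) <= L ^+ n * (ip u u + ip v v).
Proof.
move=> T0 Ts TL L0 u0 v0.
have hn : ip (iter n (op T) v) (iter n (op T) v) <= (L ^+ n) ^+ 2 * ip v v.
  elim: n => [|n IH]; first by rewrite expr0 expr1n mul1r.
  rewrite iterS; apply: le_trans (op_norm_le T0 Ts TL L0 _) _.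
    exact: iter_op_ge0.
  by rewrite (exprS L n) exprMn -[leRHS]mulrA ler_wpM2l ?sqr_ge0.
have Ln0 : 0 < L ^+ n by rewrite exprn_gt0.
apply: le_trans (ip_amgm _ _ Ln0) _.
have := ler_wpM2l (ltW (_ : 0 < (L ^+ n)^-1)) hn.
rewrite invr_gt0 => /(_ Ln0).
have -> : (L ^+ n)^-1 * ((L ^+ n) ^+ 2 * ip v v) = L ^+ n * ip v v.
  by field; rewrite expf_neq0// gt_eqF.
lra.
Qed.

Lemma ip_CauchySchwarz u v : (forall p, 0 <= u p) -> (forall p, 0 <= v p) ->
  ip u v ^+ 2 <= ip u u * ip v v.
Proof.
move=> u0 v0.
have uv0 : 0 <= ip u v.
  by apply: sumr_ge0 => p _; rewrite mulr_ge0 ?(ltW (w_gt0 _))// mulr_ge0.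
have [->|uvn0] := eqVneq (ip u v) 0; first by rewrite expr0n mulr_ge0 ?ip_ge0.
have uvp : 0 < ip u v by rewrite lt_def uvn0.
have := ip_ge0 u; rewrite le_eqVlt => /predU1P[u_eq0|uup].
  have c0 : 0 < ip u v / (ip v v + 1).
    by rewrite divr_gt0// ltr_pwDr ?ip_ge0.
  have ci0 : 0 < (ip u v / (ip v v + 1))^-1 by rewrite invr_gt0.
  have := ip_amgm u v ci0.
  rewrite -u_eq0 mulr0 add0r invrK mulrAC ler_pdivlMr ?ltr_pwDr ?ip_ge0//.
  have := ip_ge0 v; nra.
have c0 : 0 < ip u v / ip u u by rewrite divr_gt0.
have := ip_amgm u v c0.
have -> : ip u v / ip u u * ip u u = ip u v by field; rewrite gt_eqF.
rewrite invf_div => h.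
have : ip u v <= ip u u / ip u v * ip v v by lra.
by rewrite mulrAC ler_pdivlMr// expr2.
Qed.

(** [form T u u] is controlled by high powers of the operator: for normalised
[u] the moments satisfy [<u, S u>^(2^i) <= <u, S^(2^i) u>], by repeated use of
Cauchy-Schwarz. This is what makes a multiplicative loss on a power of the
operator harmless. *)
Lemma op_power_mean T u i : kernel_ge0 T -> kernel_sym T ->
  (forall p, 0 <= u p) -> 0 < ip u u ->
  form T u u ^+ (2 ^ i) * ip u u <=
    ip u u ^+ (2 ^ i) * ip u (iter (2 ^ i) (op T) u).
Proof.
move=> T0 Ts u0 uu0.
have adj n m : ip (iter m (op T) u) (iter n (op T) u) =
               ip u (iter (m + n) (op T) u).
  elim: m n => // m IH n.
  rewrite addSnnS -IH [in RHS]iterS [in RHS]ip_op form_sym// -ip_op iterS.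
  by apply: eq_bigr => p _; rewrite (mulrC (op _ _ _)).
elim: i => [|i IH].
  by rewrite expn0 !expr1 /= ip_op mulrC.
have f0 : 0 <= form T u u.
  by apply: sumr_ge0 => p _; apply: sumr_ge0 => q _; rewrite !mulr_ge0.
set b := ip u (iter (2 ^ i) (op T) u) in IH.
have hb : b ^+ 2 <= ip u u * ip u (iter (2 ^ i.+1) (op T) u).
  apply: le_trans (ip_CauchySchwarz _ _) _ => //; first exact: iter_op_ge0.
  by rewrite adj addnn -mul2n -expnS.
set c := ip u (iter (2 ^ i.+1) (op T) u) in hb *.
rewrite expnS mulnC !exprM -(ler_pM2l uu0).
have : (form T u u ^+ (2 ^ i) * ip u u) ^+ 2 <= (ip u u ^+ (2 ^ i) * b) ^+ 2.
  have lhs0 : 0 <= form T u u ^+ (2 ^ i) * ip u u.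
    by rewrite mulr_ge0 ?exprn_ge0 ?(ltW uu0).
  by rewrite ler_sqr ?nnegrE// (le_trans lhs0 IH).
rewrite !exprMn => h.
have -> : ip u u * ((form T u u ^+ (2 ^ i)) ^+ 2 * ip u u) =
  (form T u u ^+ (2 ^ i)) ^+ 2 * ip u u ^+ 2 by ring.
apply: le_trans h _.
have := ler_wpM2l (sqr_ge0 (ip u u ^+ (2 ^ i))) hb.
lra.
Qed.

End WeightedOperators.

Lemma iter_sqrtK (R : rcfType) (x : R) i : 0 <= x ->
  iter i Num.sqrt x ^+ (2 ^ i) = x.
Proof.
move=> x0; elim: i => [|i IH]; first by rewrite expr1.
rewrite iterS expnS exprM sqr_sqrtr//.
by case: (i) => //= k; rewrite sqrtr_ge0.
Qed.

(** * Localisation of the norm *)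

Section Localisation.
Context (R : realType) (X : metricType R) (A Y : finType).
Context (e : A -> X) (f : Y -> X) (C : X -> X -> set X).
Context (w : A -> R) (T : A -> A -> R) (r : R) (Q V : R -> R).
Hypothesis w_gt0 : forall p, 0 < w p.
Hypothesis T_ge0 : kernel_ge0 T.
Hypothesis T_sym : kernel_sym T.
Hypothesis T_range : forall p q, T p q != 0 -> mdist (e p) (e q) <= r.
Hypothesis r_ge0 : 0 <= r.
Hypothesis C_reach : forall x y z t, mdist x y <= t -> C x y z ->
  mdist x z <= Q t.
Hypothesis C_card : forall x y t, mdist x y <= t ->
  #|[pred j | `[< C x y (f j) >]]|%:R <= V t.
Hypothesis C_triangle : forall p q z, exists j,
  [/\ C (e p) z (f j), C z (e q) (f j) & C (e q) (e p) (f j)].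

Definition ball_kernel (z : X) (N : R) : A -> A -> R := fun p q =>
  if (mdist z (e p) <= N) && (mdist z (e q) <= N) then T p q else 0.

Definition local_bound (N L : R) : Prop :=
  forall z, form_le w (ball_kernel z N) L.

Definition on_interval (x y : X) (j : Y) : bool := `[< C x y (f j) >].

Lemma ball_kernel_ge0 z N : kernel_ge0 (ball_kernel z N).
Proof. by move=> p q; rewrite /ball_kernel; case: ifP. Qed.

Lemma ball_kernel_sym z N : kernel_sym (ball_kernel z N).
Proof. by move=> p q; rewrite /ball_kernel andbC T_sym. Qed.

Lemma ball_kernel_range z N p q :
  ball_kernel z N p q != 0 -> mdist (e p) (e q) <= r.
Proof. by rewrite /ball_kernel; case: ifP => [_ /T_range|]; rewrite ?eqxx. Qed.

Lemma card_bound_ge0 (z : X) t : 0 <= t -> 0 <= V t.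
Proof.
by move=> t0; apply: le_trans (C_card (_ : mdist z z <= t)); rewrite ?mdistxx.
Qed.

Lemma card_on_interval x y t : mdist x y <= t ->
  #|[pred j | on_interval x y j]|%:R <= V t.
Proof. exact: C_card. Qed.

Lemma sum_mulrb (P : pred Y) (x : R) :
  \sum_j x * (P j)%:R = x * #|[pred j | P j]|%:R.
Proof.
rewrite -mulr_sumr -natr_sum; congr (_ * _%:R).
rewrite -sum1_card [RHS]big_mkcond/=; apply: eq_bigr => j _.
by rewrite inE; case: (P j).
Qed.

(** Inside a ball with centre [z], charge the pair [(p,q)] to a point common to
[C p z], [C z q] and [C q p]. Each [p] is involved with at most [2 V N] points,
since its distance to [z] is at most [N], and the pairs charged to one point
satisfy the assumed bound. *)
Lemma local_bound_base (N : R) : 0 <= N ->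
  (forall j (v : A -> R), (forall p, 0 <= v p) ->
     form (fun p q => if on_interval (e p) (e q) j || on_interval (e q) (e p) j
                      then T p q else 0) v v <= ip w v v) ->
  local_bound N (2 * V N).
Proof.
move=> N0 masked z u u0.
pose P p j := (mdist z (e p) <= N) &&
  (on_interval (e p) z j || on_interval z (e p) j).
pose v j p := u p * (P p j)%:R.
have v0 j p : 0 <= v j p by rewrite mulr_ge0.
apply: le_trans (_ : \sum_j ip w (v j) (v j) <= _); last first.
  rewrite exchange_big /ip mulr_sumr; apply: ler_sum => p _.
  rewrite -mulr_sumr mulrCA ler_wpM2l ?(ltW (w_gt0 _))//.
  have -> : \sum_j v j p * v j p = (u p * u p) * #|[pred j | P p j]|%:R.
    rewrite -sum_mulrb; apply: eq_bigr => j _; rewrite /v.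
    by case: (P p j); rewrite ?mulr1 ?mulr0.
  rewrite mulrC ler_wpM2r ?mulr_ge0//.
  have [zp|zp] := leP (mdist z (e p)) N; last first.
    rewrite eq_card0 ?mulr_ge0 ?(card_bound_ge0 z)// => j.
    by rewrite inE /= /P leNgt zp.
  have pz : mdist (e p) z <= N by rewrite metric_sym.
  apply: le_trans (_ : #|[pred j | on_interval (e p) z j]|%:R +
    #|[pred j | on_interval z (e p) j]|%:R <= _).
    rewrite -natrD ler_nat; rewrite -cardUI.
    apply: leq_trans (leq_addr _ _); apply: subset_leq_card.
    by apply/fintype.subsetP => j; rewrite !inE /= /P zp.
  by have := card_on_interval zp; have := card_on_interval pz; lra.
apply: le_trans (_ : \sum_j form (fun p q =>
  if on_interval (e p) (e q) j || on_interval (e q) (e p) j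
  then T p q else 0) (v j) (v j) <= _); last first.
  by apply: ler_sum => j _; apply: masked.
rewrite /form [leRHS]exchange_big/=; apply: ler_sum => p _.
rewrite [leRHS]exchange_big/=; apply: ler_sum => q _.
have all0 (j : Y) : 0 <= (if on_interval (e p) (e q) j ||
  on_interval (e q) (e p) j then T p q else 0) * (v j p * v j q).
  by case: ifP => _; rewrite ?mul0r// !mulr_ge0.
rewrite /ball_kernel; case: ifP => [/andP[zp zq]|_]; last first.
  by rewrite mul0r sumr_ge0.
have [j [Cpz Czq Cqp]] := C_triangle p q z.
rewrite (bigD1 j)//=; apply: ler_wpDr; first exact: sumr_ge0.
have -> : on_interval (e q) (e p) j by apply/asboolP.
rewrite orbT /v /P zp zq /=.
have -> : on_interval (e p) z j by apply/asboolP.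
have -> : on_interval z (e q) j by apply/asboolP.
by rewrite orbT !mulr1.
Qed.

(** The value at [p] of an [n]-th power of the operator depends only on the
ball of radius [n r] about [p]. *)
Lemma iter_op_local (T1 T2 : A -> A -> R) n p (v1 v2 : A -> R) :
  kernel_ge0 T1 -> kernel_ge0 T2 ->
  (forall q q', T1 q q' != 0 -> mdist (e q) (e q') <= r) ->
  (forall q, 0 <= v1 q) -> (forall q, 0 <= v2 q) ->
  (forall q q', mdist (e p) (e q) <= n%:R * r ->
     mdist (e p) (e q') <= n%:R * r -> T1 q q' <= T2 q q') ->
  (forall q, mdist (e p) (e q) <= n%:R * r -> v1 q <= v2 q) ->
  iter n (op w T1) v1 p <= iter n (op w T2) v2 p.
Proof.
move=> T10 T20 T1r v10 v20; elim: n p => [|n IH] p T12 v12.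
  by apply: v12; rewrite mdistxx mul0r.
have nr0 : 0 <= n%:R * r by rewrite mulr_ge0.
have nS : n.+1%:R * r = n%:R * r + r by rewrite -natr1; ring.
rewrite !iterS /op ler_pM2r ?invr_gt0//; apply: ler_sum => q _.
have [->|T1pq] := eqVneq (T1 p q) 0.
  by rewrite mul0r mulr_ge0// iter_op_ge0.
have pq := T1r _ _ T1pq.
have far q' : mdist (e q) (e q') <= n%:R * r ->
    mdist (e p) (e q') <= n.+1%:R * r.
  by move=> qq'; have := metric_triangle (e p) (e q) (e q'); rewrite nS; lra.
apply: ler_pM => //; first exact: iter_op_ge0.
  by apply: T12; rewrite ?mdistxx nS; [rewrite addr_ge0|rewrite ler_wpDl].
apply: IH => [q' q'' h h'|q' h]; first by apply: T12; apply: far.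
by apply: v12; apply: far.
Qed.

Lemma iter_op_sum n (T1 : A -> A -> R) (P : pred Y) (v : Y -> A -> R) p :
  iter n (op w T1) (fun q => \sum_(j | P j) v j q) p =
  \sum_(j | P j) iter n (op w T1) (v j) p.
Proof.
elim: n p => // n IH p; rewrite !iterS /op.
under eq_bigr do rewrite IH mulr_sumr.
by rewrite exchange_big/= mulr_suml.
Qed.

(** The charging argument for walks of length [n]. A point [j] charged by a
pair [(p,q)] at distance at most [n r] lies in [C q p], hence near [p], and the
whole walk from [p] stays in the ball of radius [N] about [j], where the norm
is at most [L]. The multiplicity of the charging is governed by the distance
[N'] to the centre [z], and it enters only once, not [n] times. *)
Lemma iter_op_ball_le z (N N' a L : R) n (u : A -> R) :
  0 < L -> local_bound N L -> 0 <= N' ->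
  Q (n%:R * r) + n%:R * r <= a -> a + n%:R * r <= N ->
  (forall p, 0 <= u p) -> (forall p, ~~ (mdist z (e p) <= N') -> u p = 0) ->
  ip w u (iter n (op w (ball_kernel z N')) u) <= L ^+ n * V N' * ip w u u.
Proof.
move=> L0 locL N'0 aQ aN u0 usupp.
pose D p j := on_interval (e p) z j && (mdist (f j) (e p) <= a).
pose E q j := on_interval z (e q) j.
pose uD j p := u p * (D p j)%:R.
pose uE j q := u q * (E q j)%:R.
have uD0 j p : 0 <= uD j p by rewrite mulr_ge0.
have uE0 j p : 0 <= uE j p by rewrite mulr_ge0.
set nr := n%:R * r in aQ aN.
have nr0 : 0 <= nr by rewrite mulr_ge0.
have step p : iter n (op w (ball_kernel z N')) u p <=
    \sum_(j | D p j) iter n (op w (ball_kernel (f j) N)) (uE j) p.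
  apply: le_trans (_ : iter n (op w (ball_kernel z N'))
    (fun q => \sum_(j | D p j) uE j q) p <= _).
    apply: iter_op_local => //; try exact: ball_kernel_ge0.
    - exact: ball_kernel_range.
    - by move=> q; apply: sumr_ge0.
    move=> q pq; have [j [Cpz Czq Cqp]] := C_triangle p q z.
    have qp : mdist (e q) (e p) <= nr by rewrite metric_sym.
    have Dpj : D p j.
      rewrite /D; apply/andP; split; first exact/asboolP.
      have := C_reach qp Cqp; have := metric_triangle (f j) (e q) (e p).
      by rewrite (metric_sym (f j) (e q)); lra.
    rewrite (bigD1 j)//= {1}/uE.
    have -> : E q j by apply/asboolP.
    by rewrite mulr1 lerDl sumr_ge0.
  rewrite iter_op_sum; apply: ler_sum => j /andP[_ jp].
  apply: iter_op_local => //; try exact: ball_kernel_ge0.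
    exact: ball_kernel_range.
  move=> q q' pq pq'; rewrite /ball_kernel.
  have jq : mdist (f j) (e q) <= N.
    by have := metric_triangle (f j) (e p) (e q); rewrite -/nr in pq; lra.
  have jq' : mdist (f j) (e q') <= N.
    by have := metric_triangle (f j) (e p) (e q'); rewrite -/nr in pq'; lra.
  by rewrite jq jq' /=; case: ifP.
apply: le_trans (_ : \sum_j ip w (uD j)
   (iter n (op w (ball_kernel (f j) N)) (uE j)) <= _).
  rewrite exchange_big/=; apply: ler_sum => p _.
  rewrite -mulr_sumr ler_wpM2l ?(ltW (w_gt0 _))//.
  apply: le_trans (ler_wpM2l (u0 p) (step p)) _.
  rewrite mulr_sumr big_mkcond/=; apply: ler_sum => j _.
  by rewrite /uD; case: (D p j); rewrite ?mulr1// mulr0 mul0r.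
apply: le_trans (_ : \sum_j L ^+ n / 2 *
  (ip w (uD j) (uD j) + ip w (uE j) (uE j)) <= _).
  apply: ler_sum => j _.
  have := iter_op_form_le w_gt0 n (@ball_kernel_ge0 (f j) N)
    (@ball_kernel_sym (f j) N) (locL (f j)) L0 (uD0 j) (uE0 j).
  lra.
rewrite -mulr_sumr -mulrA -mulrA ler_wpM2l ?exprn_ge0 ?(ltW L0)//.
rewrite mulrC ler_pdivrMr//.
rewrite big_split/= /ip [X in X + _ <= _]exchange_big.
rewrite [X in _ + X <= _]exchange_big/=.
rewrite -big_split mulr_sumr mulr_suml/=; apply: ler_sum => p _.
rewrite -!mulr_sumr.
have -> : \sum_j uD j p * uD j p = (u p * u p) * #|[pred j | D p j]|%:R.
  rewrite -sum_mulrb; apply: eq_bigr => j _; rewrite /uD.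
  by case: (D p j); rewrite ?mulr1 ?mulr0.
have -> : \sum_j uE j p * uE j p = (u p * u p) * #|[pred j | E p j]|%:R.
  rewrite -sum_mulrb; apply: eq_bigr => j _; rewrite /uE.
  by case: (E p j); rewrite ?mulr1 ?mulr0.
have [zp|zp] := boolP (mdist z (e p) <= N'); last first.
  by rewrite usupp// !(mul0r, mulr0) addr0.
have pz : mdist (e p) z <= N' by rewrite metric_sym.
have cE := card_on_interval zp; have cD := card_on_interval pz.
have cD' : #|[pred j | D p j]|%:R <= V N'.
  apply: le_trans cD; rewrite ler_nat.
  apply: subset_leq_card; apply/fintype.subsetP => j.
  by rewrite !inE => /andP[/asboolP].
have wu0 : 0 <= w p * (u p * u p) by rewrite !mulr_ge0// (ltW (w_gt0 p)).
have := ler_wpM2l wu0 cE; have := ler_wpM2l wu0 cD'.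
rewrite /E; lra.
Qed.

(** Taking [2^i]-th roots in the previous estimate, through the moments of a
vector [u] supported in the ball. *)
Lemma local_bound_step (N N' a L L' : R) i :
  0 < L -> 0 < L' -> local_bound N L -> 0 <= N' ->
  Q ((2 ^ i)%:R * r) + (2 ^ i)%:R * r <= a -> a + (2 ^ i)%:R * r <= N ->
  L ^+ (2 ^ i) * V N' <= L' ^+ (2 ^ i) ->
  local_bound N' L'.
Proof.
move=> L0 L'0 locL N'0 aQ aN LL' z u0 u0_ge0.
pose u p := if mdist z (e p) <= N' then u0 p else 0.
have u_ge0 p : 0 <= u p by rewrite /u; case: ifP.
have uu : ip w u u <= ip w u0 u0.
  apply: ler_sum => p _; rewrite ler_wpM2l ?(ltW (w_gt0 _))// /u.
  by case: ifP => _; rewrite // mul0r mulr_ge0.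
have -> : form (ball_kernel z N') u0 u0 = form (ball_kernel z N') u u.
  apply: eq_bigr => p _; apply: eq_bigr => q _; rewrite /ball_kernel /u.
  by case: (_ <= N'); case: (_ <= N'); rewrite ?mul0r.
apply: le_trans (_ : L' * ip w u u <= _); last by rewrite ler_pM2l.
have := ip_ge0 w_gt0 u; rewrite le_eqVlt => /predU1P[uu0|uup].
  have u_eq0 p : u p = 0.
    have /eqP : \sum_q w q * (u q * u q) = 0 by rewrite /ip in uu0.
    rewrite psumr_eq0 => [/allP/(_ p)|q _]; last first.
      by rewrite !mulr_ge0 ?(ltW (w_gt0 q)).
    by rewrite mem_index_enum mulf_eq0 gt_eqF//= mulf_eq0 orbb => /(_ isT)/eqP.
  rewrite -uu0 mulr0 /form big1// => p _; rewrite big1// => q _.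
  by rewrite u_eq0 mul0r mulr0.
set F := form _ u u.
have F0 : 0 <= F.
  apply: sumr_ge0 => p _; apply: sumr_ge0 => q _.
  by rewrite !mulr_ge0// ball_kernel_ge0.
have LU0 : 0 <= L' * ip w u u by rewrite mulr_ge0 ?(ltW L'0) ?(ltW uup).
rewrite -(@ler_pXn2r _ (2 ^ i)) ?expn_gt0 ?nnegrE//.
have pm := op_power_mean w_gt0 i (@ball_kernel_ge0 z N')
  (@ball_kernel_sym z N') u_ge0 uup.
have usupp p : ~~ (mdist z (e p) <= N') -> u p = 0 by rewrite /u => /negPf ->.
have lp := iter_op_ball_le L0 locL N'0 aQ aN u_ge0 usupp.
rewrite -(ler_pM2r uup) exprMn; apply: le_trans pm _.
apply: le_trans (ler_wpM2l _ lp) _; first by rewrite exprn_ge0 ?ltW.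
have := ler_wpM2l (_ : 0 <= ip w u u ^+ (2 ^ i) * ip w u u) LL'.
rewrite mulr_ge0 ?exprn_ge0 ?(ltW uup)// => /(_ isT); lra.
Qed.

(** With [n = 2^i] the [i]-th step multiplies the bound by [(K D^i)^(1 / 2^i)].
The closed form proved here is the [2^i]-th power of [L <= L0 (K D)^2 / (K
D^(i+1))^(2 / 2^i)], whose denominator is the product of the losses still to
come. *)
Lemma local_bound_chain (N : nat -> R) (L0 K D : R) :
  0 < L0 -> 1 <= K -> 1 <= D -> (forall i, 0 <= N i) ->
  (forall i, Q ((2 ^ i)%:R * r) + (2 ^ i)%:R * r + (2 ^ i)%:R * r <= N i) ->
  (forall i, V (N i.+1) <= K * D ^+ i) ->
  local_bound (N 0%N) L0 ->
  forall i, exists L, [/\ 0 < L, local_bound (N i) L &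
    K ^+ 2 * (D ^+ i.+1) ^+ 2 * L ^+ (2 ^ i) <=
      (L0 * (K * D) ^+ 2) ^+ (2 ^ i)].
Proof.
move=> L0p K1 D1 N0 QN VN loc0.
have K0 : 0 < K by apply: lt_le_trans K1.
have D0 : 0 < D by apply: lt_le_trans D1.
elim=> [|i [L [Lp locL hL]]].
  by exists L0; split=> //; rewrite !expr1 exprMn; lra.
pose x := K * D ^+ i.
have x0 : 0 < x by rewrite mulr_gt0// exprn_gt0.
pose rho := iter i Num.sqrt x.
have rho0 : 0 < rho.
  by rewrite /rho; elim: (i) => //= k IH; rewrite sqrtr_gt0.
have rhoK : rho ^+ (2 ^ i) = x by apply: iter_sqrtK; rewrite ltW.
exists (L * rho); split; first by rewrite mulr_gt0.
  apply: (local_bound_step Lp _ locL (N0 i.+1) (lexx _) (QN i)).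
    by rewrite mulr_gt0.
  by rewrite exprMn rhoK ler_wpM2l ?exprn_ge0 ?(ltW Lp).
set G := L0 * (K * D) ^+ 2 in hL *.
rewrite expnS mulnC !exprM (exprMn _ L rho) rhoK /x.
have Ln0 : 0 <= L ^+ (2 ^ i) by rewrite exprn_ge0 ?ltW.
set Ln := L ^+ (2 ^ i) in hL Ln0 *.
have -> : K ^+ 2 * D ^+ i.+2 ^+ 2 * (Ln * (K * D ^+ i)) ^+ 2 =
  (K ^+ 2 * (D ^+ i.+1) ^+ 2 * Ln) ^+ 2 by rewrite !exprS; ring.
have l0 : 0 <= K ^+ 2 * D ^+ i.+1 ^+ 2 * Ln.
  by rewrite mulr_ge0// mulr_ge0 ?sqr_ge0.
by rewrite ler_sqr ?nnegrE// (le_trans l0).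
Qed.

(** The finite set [A] lies in one ball of the exhausting sequence [N], so the
uniform bound along the chain is a bound on the whole kernel. *)
Lemma form_le_global (N : nat -> R) (L0 K D : R) :
  0 < L0 -> 1 <= K -> 1 <= D -> (forall i, 0 <= N i) ->
  (forall i, Q ((2 ^ i)%:R * r) + (2 ^ i)%:R * r + (2 ^ i)%:R * r <= N i) ->
  (forall i, V (N i.+1) <= K * D ^+ i) ->
  (forall x, exists i, x <= N i) ->
  local_bound (N 0%N) L0 ->
  form_le w T (L0 * (K * D) ^+ 2).
Proof.
move=> L0p K1 D1 N0 QN VN N_unbounded loc0 u u0.
have [p0 _|A0] := pickP (fun _ : A => true); last first.
  by rewrite /form /ip !big_pred0 ?mulr0// => p; have := A0 p.
have [i hi] := N_unbounded (\sum_p mdist (e p0) (e p)).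
have near p : mdist (e p0) (e p) <= N i.
  apply: le_trans hi; rewrite (bigD1 p)//= lerDl.
  by apply: sumr_ge0 => q _; apply: mdist_ge0.
have [L [Lp locL hL]] := local_bound_chain L0p K1 D1 N0 QN VN loc0 i.
have LG : L <= L0 * (K * D) ^+ 2.
  rewrite -(@ler_pXn2r _ (2 ^ i)) ?expn_gt0// ?nnegrE ?(ltW Lp)//; last first.
    by rewrite mulr_ge0 ?(ltW L0p)// sqr_ge0.
  apply: le_trans hL; rewrite ler_peMl ?exprn_ge0 ?(ltW Lp)//.
  rewrite -exprMn -[leLHS](expr1n _ 2) ler_sqr ?nnegrE//.
    by rewrite mulr_ege1// exprn_ege1.
  by rewrite (le_trans ler01)// mulr_ege1// exprn_ege1.
have -> : form T u u = form (ball_kernel (e p0) (N i)) u u.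
  by apply: eq_bigr => p _; apply: eq_bigr => q _; rewrite /ball_kernel !near.
by apply: le_trans (locL (e p0) u u0) _; rewrite ler_wpM2r ?ip_ge0.
Qed.

End Localisation.

Lemma sqrtM_concave (R : rcfType) (a b a' b' t : R) :
  0 <= a -> 0 <= b -> 0 <= a' -> 0 <= b' -> 0 <= t <= 1 ->
  (1 - t) * Num.sqrt (a * b) + t * Num.sqrt (a' * b') <=
  Num.sqrt (((1 - t) * a + t * a') * ((1 - t) * b + t * b')).
Proof.
move=> a0 b0 a'0 b'0 /andP[t0 t1].
have t1' : 0 <= 1 - t by rewrite subr_ge0.
rewrite (sqrtrM b a0) (sqrtrM b' a'0) -[leLHS]ger0_norm; last first.
  by rewrite addr_ge0// !mulr_ge0// sqrtr_ge0.
rewrite -sqrtr_sqr; apply: ler_wsqrtr.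
rewrite -{2}(sqr_sqrtr a0) -{2}(sqr_sqrtr b0).
rewrite -{2}(sqr_sqrtr a'0) -{2}(sqr_sqrtr b'0).
set x := Num.sqrt a; set y := Num.sqrt b.
set x' := Num.sqrt a'; set y' := Num.sqrt b'.
have : 0 <= (1 - t) * t * (x * y' - x' * y) ^+ 2.
  by rewrite mulr_ge0 ?sqr_ge0 ?mulr_ge0.
lra.
Qed.

(** * Selections by duality *)

Section FractionalSelection.
Context (R : realType) (A Y : finType) (E : rel A) (M : A -> A -> pred Y).
Hypothesis E_sym : symmetric E.
Hypothesis M_sym : forall p q j, M p q j = M q p j.

Definition masked (T : A -> A -> R) (j : Y) : A -> A -> R :=
  fun p q => if M p q j then T p q else 0.

(** The number [a p j] is the fraction of the point [j] that is granted to [p],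
and a pair [p q] is served by [j] up to the geometric mean of the two
fractions. The geometric mean, rather than the minimum, is what turns the dual
constraints into bounds on quadratic forms. *)
Lemma fractional_selection (G theta : R) : 0 < theta <= 2 -> theta * G < 1 ->
  (forall (w : A -> R) (T : A -> A -> R),
     (forall p, 0 < w p) -> kernel_ge0 T -> kernel_sym T ->
     (forall p q, T p q != 0 -> E p q) ->
     (forall j v, (forall p, 0 <= v p) ->
        form (masked T j) v v <= ip w v v) ->
     \sum_p \sum_q T p q <= G * \sum_p w p) ->
  exists a : A -> Y -> R, [/\ forall p j, 0 <= a p j,
    forall p, \sum_j a p j <= 2 &
    forall p q, E p q ->
      theta / 2 <= \sum_(j | M p q j) Num.sqrt (a p j * a q j)].
Proof.
move=> /andP[th0 th2] thG no_dual.
(* Bounding the total mass makes the payoffs bounded; [#|A|] is what the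
   constraints on the rows allow. *)
pose B : R := #|A|%:R.
have B0 : 0 <= B by rewrite ler0n.
pose mass_le (a : A -> Y -> R) : Prop := (forall p j, 0 <= a p j) /\
  \sum_p \sum_j a p j <= B.
pose K := {a | mass_le a}.
pose s (a : K) (i : A + A * A) : R := match i with
  | inl p => 1 - \sum_j sval a p j
  | inr (p, q) => if E p q then
      \sum_(j | M p q j) Num.sqrt (sval a p j * sval a q j) - theta else 0
  end.
have zero_in : mass_le (fun _ _ => 0).
  by split => //; rewrite big1// => p _; rewrite big1.
pose a0 : K := exist _ (fun _ _ => 0) zero_in.
have row_le (a : K) p : 0 <= \sum_j sval a p j <= B.
  case: a => a [a_ge0 aB] /=; rewrite sumr_ge0//=.
  apply: le_trans aB; rewrite (bigD1 p)//= lerDl.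
  by apply: sumr_ge0 => q _; apply: sumr_ge0.
have sbnd a i : `|s a i| <= 2 * B + 1 + theta.
  case: i => [p|[p q]] /=.
    by have /andP[? ?] := row_le a p; rewrite ler_norml; apply/andP; split; lra.
  case: ifP => _; last by rewrite normr0; lra.
  have s0 : 0 <= \sum_(j | M p q j) Num.sqrt (sval a p j * sval a q j).
    by apply: sumr_ge0 => j _; rewrite sqrtr_ge0.
  have s1 : \sum_(j | M p q j) Num.sqrt (sval a p j * sval a q j) <= 
      \sum_j sval a p j + \sum_j sval a q j.
    rewrite -big_split/= big_mkcond/=; apply: ler_sum => j _.
    have [x0 _] := svalP a; have xp := x0 p j; have xq := x0 q j.
    case: ifP => _; last by rewrite addr_ge0.
    rewrite -[leRHS]ger0_norm ?addr_ge0// -sqrtr_sqr; apply: ler_wsqrtr; nra.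
  have /andP[? ?] := row_le a p; have /andP[? ?] := row_le a q.
  by rewrite ler_norml; apply/andP; split; lra.
have sconc (a a' : K) (t : R) : 0 <= t <= 1 ->
    exists a'', forall i, (1 - t) * s a i + t * s a' i <= s a'' i.
  move=> t01; have /andP[t0 t1] := t01.
  have t1' : 0 <= 1 - t by rewrite subr_ge0.
  have [x0 xB] := svalP a; have [y0 yB] := svalP a'.
  have comb_in : mass_le (fun p j => (1 - t) * sval a p j + t * sval a' p j).
    split=> [p j|]; first by rewrite addr_ge0 ?mulr_ge0.
    under eq_bigr do rewrite big_split/= -!mulr_sumr.
    rewrite big_split/= -!mulr_sumr.
    have := ler_wpM2l t1' xB; have := ler_wpM2l t0 yB; lra.
  exists (exist _ _ comb_in) => -[p|[p q]] /=.
    by rewrite big_split/= -!mulr_sumr; lra.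
  case: ifP => _; last by rewrite !mulr0 addr0.
  have : (1 - t) * (\sum_(j | M p q j) Num.sqrt (sval a p j * sval a q j)) +
      t * (\sum_(j | M p q j) Num.sqrt (sval a' p j * sval a' q j)) <=
    \sum_(j | M p q j) Num.sqrt (((1 - t) * sval a p j + t * sval a' p j) *
      ((1 - t) * sval a q j + t * sval a' q j)).
    rewrite !mulr_sumr -big_split/=; apply: ler_sum => j _.
    exact: sqrtM_concave.
  lra.
have th20 : 0 < theta / 2 by rewrite divr_gt0.
have [[a ha]|[l l0 hl]] := concave_alternative a0 sbnd sconc th20.
  exists (sval a); split=> [||p q Epq]; first by case: (svalP a).
    by move=> p; have := ha (inl p) => /=; lra.
  by have := ha (inr (p, q)) => /=; rewrite Epq; lra.
exfalso.
pose w0 p := l (inl p).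
pose T0 p q := if E p q then l (inr (p, q)) else 0.
have T00 p q : 0 <= T0 p q by rewrite /T0; case: ifP.
have dualE (a : K) : \sum_p w0 p * (1 - \sum_j sval a p j) +
   \sum_p \sum_q T0 p q *
     (\sum_(j | M p q j) Num.sqrt (sval a p j * sval a q j) - theta) < 0.
  apply: le_lt_trans (hl a); rewrite big_sumType/= lerD2l.
  rewrite pair_bigA/= le_eqVlt; apply/orP; left; apply/eqP.
  apply: eq_bigr => -[p q] _ /=; rewrite /T0.
  by case: ifP; rewrite ?mul0r ?mulr0.
pose S0 := \sum_p \sum_q T0 p q.
pose c := theta * S0 - \sum_p w0 p.
have c0 : 0 < c.
  have := dualE a0.
  have -> : \sum_p w0 p * (1 - \sum_j sval a0 p j) = \sum_p w0 p.
    by apply: eq_bigr => p _; rewrite big1// subr0 mulr1.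
  have -> : \sum_p \sum_q T0 p q *
      (\sum_(j | M p q j) Num.sqrt (sval a0 p j * sval a0 q j) - theta) =
      - theta * S0.
    rewrite /S0 mulr_sumr; apply: eq_bigr => p _.
    rewrite mulr_sumr; apply: eq_bigr => q _.
    by rewrite big1 ?sub0r ?(mulrC (- theta))// => j _; rewrite mul0r sqrtr0.
  by rewrite /c; lra.
have S0_gt0 : 0 < S0.
  have : 0 <= \sum_p w0 p by apply: sumr_ge0 => p _; exact: l0.
  move=> h; rewrite -(pmulr_rgt0 _ th0); rewrite /c in c0; lra.
have B_gt0 : 0 < B.
  rewrite ltr0n lt0n; apply/negP => /eqP/card0_eq A0.
  by move: S0_gt0; rewrite /S0 big1 ?ltxx// => p; have := A0 p; rewrite inE.
(* Adding the slack [c], spread evenly, absorbs the bound on the total mass and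
   makes the weights positive. *)
pose w p := w0 p + c / B.
pose T p q := (T0 p q + T0 q p) / 2.
have ww : \sum_p w p = theta * S0.
  rewrite big_split/= sumr_const -mulr_natr.
  by rewrite -/B divfK ?gt_eqF// /c; lra.
have TT : \sum_p \sum_q T p q = S0.
  rewrite /T; under eq_bigr do rewrite -mulr_suml big_split/=.
  by rewrite -mulr_suml big_split/= [X in _ + X]exchange_big/= -/S0; field.
have := no_dual w T; rewrite ww TT => /(_ _ _ _ _ _)/wrap[] //; last first.
- by move=> h; have := ltr_pM2r S0_gt0 (theta * G) 1; rewrite thG; lra.
- move=> j v v0.
  have formT : form (masked T j) v v = form (masked T0 j) v v.
    have -> : form (masked T j) v v = (form (masked T0 j) v v + 
        \sum_p \sum_q masked T0 j q p * (v p * v q)) / 2.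
      rewrite /form -big_split mulr_suml/=; apply: eq_bigr => p _.
      rewrite -big_split mulr_suml/=; apply: eq_bigr => q _.
      by rewrite /masked /T M_sym; case: ifP => _; field.
    have -> : \sum_p \sum_q masked T0 j q p * (v p * v q) =
        form (masked T0 j) v v.
      rewrite exchange_big; apply: eq_bigr => p _; apply: eq_bigr => q _.
      by rewrite (mulrC (v q)).
    by field.
  rewrite formT.
  pose vv := \sum_p v p * v p.
  have vv0 : 0 <= vv by apply: sumr_ge0 => p _; rewrite mulr_ge0.
  have ipE : ip w v v = ip w0 v v + c / B * vv.
    rewrite /ip /vv mulr_sumr -big_split; apply: eq_bigr => p _.
    by rewrite /w mulrDl.
  have [vv_eq0|vvn0] := eqVneq vv 0.
    have v_eq0 p : v p = 0.
      move/eqP : vv_eq0.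
      rewrite psumr_eq0 => [/allP/(_ p)|q _]; last by rewrite mulr_ge0.
      by rewrite mem_index_enum mulf_eq0 orbb => /(_ isT)/eqP.
    rewrite /form /ip !big1// => p _; first by rewrite v_eq0 !mulr0.
    by rewrite big1// => q _; rewrite v_eq0 mul0r mulr0.
  have vvp : 0 < vv by rewrite lt_def vvn0.
  pose t := B / vv.
  have t0 : 0 < t by rewrite divr_gt0.
  have atom_in : mass_le (fun p j' => if j' == j then t * (v p * v p) else 0).
    split=> [p j'|].
      by case: ifP => // _; rewrite mulr_ge0 ?(ltW t0)// mulr_ge0.
    under eq_bigr do rewrite -big_mkcond big_pred1_eq.
    by rewrite -mulr_sumr /t divfK.
  have := dualE (exist _ _ atom_in).
  have -> : \sum_p w0 p * (1 - \sum_j' sval (exist mass_le _ atom_in) p j') =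
      \sum_p w0 p - t * ip w0 v v.
    rewrite /ip mulr_sumr -sumrB; apply: eq_bigr => p _ /=.
    by rewrite -big_mkcond big_pred1_eq; ring.
  have -> : \sum_p \sum_q T0 p q * (\sum_(j' | M p q j')
        Num.sqrt (sval (exist mass_le _ atom_in) p j' *
                  sval (exist mass_le _ atom_in) q j') - theta) =
      t * form (masked T0 j) v v - theta * S0.
    rewrite /S0 /form !mulr_sumr -sumrB; apply: eq_bigr => p _.
    rewrite !mulr_sumr -sumrB; apply: eq_bigr => q _ /=.
    rewrite big_mkcond (bigD1 j)//= eqxx big1 => [|j' /negPf ->]; last first.
      by rewrite mul0r sqrtr0 if_same.
    have -> : t * (v p * v p) * (t * (v q * v q)) = (t * (v p * v q)) ^+ 2.
      by ring.
    rewrite sqrtr_sqr ger0_norm; last by rewrite mulr_ge0 ?(ltW t0)// mulr_ge0.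
    by rewrite /masked; case: ifP => _; ring.
  rewrite ipE => h.
  have : t * (form (masked T0 j) v v - ip w0 v v) <= c by rewrite /c; lra.
  rewrite mulrC -ler_pdivlMr// /t invf_div mulrA => ?.
  have -> : c / B * vv = c * vv / B by ring.
  lra.
- move=> p q; rewrite /T /T0 E_sym.
  by case: (E q p) => //; rewrite addr0 mul0r eqxx.
- by move=> p q; rewrite /T addrC.
- by move=> p q; rewrite /T divr_ge0 ?addr_ge0.
- by move=> p; apply: ltr_wpDl; [exact: l0 | exact: divr_gt0].
Qed.

(** Rounding: a pair has at most [m] candidates, so one of them carries a
fraction [1 / m] of the service, and since no [a p j] exceeds [2], both
endpoints then hold at least [tau] of that candidate. A row of mass [2] has at
most [2 / tau] such entries. *)
Lemma selection_of_fractional (a : A -> Y -> R) (theta m : R) :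
  0 < theta -> 0 < m ->
  (forall p j, 0 <= a p j) -> (forall p, \sum_j a p j <= 2) ->
  (forall p q, E p q ->
      theta / 2 <= \sum_(j | M p q j) Num.sqrt (a p j * a q j)) ->
  (forall p q, E p q -> #|M p q|%:R <= m) ->
  exists F : A -> pred Y, (forall p, #|F p|%:R <= 16 * m ^+ 2 / theta ^+ 2) /\
    forall p q, E p q -> exists j, [/\ M p q j, F p j & F q j].
Proof.
move=> th0 m0 a0 a2 aM Mm.
pose tau := theta ^+ 2 / (8 * m ^+ 2).
have tau0 : 0 < tau by rewrite divr_gt0 ?exprn_gt0// mulr_gt0// exprn_gt0.
have ale p j : a p j <= 2.
  apply: le_trans (a2 p); rewrite (bigD1 j)//= lerDl.
  by apply: sumr_ge0.
exists (fun p => [pred j | tau <= a p j]); split=> [p|p q Epq].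
  have -> : 16 * m ^+ 2 / theta ^+ 2 = 2 / tau.
    by rewrite /tau; field; rewrite !gt_eqF.
  rewrite ler_pdivlMr//; apply: le_trans (a2 p).
  rewrite -sum1_card natr_sum mulr_suml big_mkcond/=; apply: ler_sum => j _.
  by rewrite unfold_in /=; case: ifP => // h; rewrite mul1r.
have [j Mj hj] : exists2 j, M p q j &
    theta / (2 * m) <= Num.sqrt (a p j * a q j).
  apply: contrapT => no.
  have lt j : M p q j -> Num.sqrt (a p j * a q j) < theta / (2 * m).
    by move=> Mj; rewrite ltNge; apply/negP => h; apply: no; exists j.
  have th2m0 : 0 < theta / (2 * m) by rewrite divr_gt0// mulr_gt0.
  have := aM _ _ Epq.
  have th20 : 0 < theta / 2 by rewrite divr_gt0.
  have [/existsP[j0 Mj0]|/existsPn none] := boolP [exists j, M p q j];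
      last first.
    rewrite big1 => [|j Mj]; first by rewrite leNgt th20.
    by rewrite (negPf (none j)) in Mj.
  rewrite leNgt => /negP; apply.
  apply: lt_le_trans (_ : \sum_(j | M p q j) theta / (2 * m) <= _); last first.
    rewrite sumr_const -(mulr_natr _ #|_|).
    have := ler_wpM2l (ltW th2m0) (Mm _ _ Epq).
    by have -> : theta / (2 * m) * m = theta / 2 by field; rewrite gt_eqF.
  apply: ltr_sum => [|j Mj]; last exact: lt.
  by apply/hasP; exists j0 => //; rewrite mem_index_enum.
have h2 : (theta / (2 * m)) ^+ 2 <= a p j * a q j.
  have := hj; rewrite -[a p j * a q j]sqr_sqrtr ?mulr_ge0// => h.
  by rewrite ler_sqr// nnegrE ?sqrtr_ge0// divr_ge0 ?(ltW th0)// mulr_ge0 ?ltW.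
have e2 : (theta / (2 * m)) ^+ 2 = 2 * tau.
  by rewrite /tau; field; rewrite gt_eqF.
exists j; split=> //=.
  have := ler_wpM2l (a0 p j) (ale q j); lra.
have := ler_wpM2r (a0 q j) (ale p j); lra.
Qed.

End FractionalSelection.

(** * Polynomials with nonnegative coefficients *)

Lemma nonneg_polyP (R : realType) (p : {poly R}) :
  nonneg_poly p <-> forall i, 0 <= p`_i.
Proof.
split=> [/polyOverP h i|h]; first by have := h i; rewrite nnegrE.
by apply/polyOverP => i; rewrite nnegrE.
Qed.

Section NonnegPoly.
Context (R : realType).
Implicit Types p q : {poly R}.

Lemma nonneg_poly_ge0 p (t : R) : nonneg_poly p -> 0 <= t -> 0 <= p.[t].
Proof.
move=> /nonneg_polyP p0 t0; rewrite horner_coef; apply: sumr_ge0 => i _.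
by rewrite mulr_ge0// exprn_ge0.
Qed.

Lemma nonneg_poly_mono p (s t : R) : nonneg_poly p -> 0 <= s -> s <= t ->
  p.[s] <= p.[t].
Proof.
move=> /nonneg_polyP p0 s0 st; rewrite !horner_coef; apply: ler_sum => i _.
by rewrite ler_wpM2l// lerXn2r// nnegrE// (le_trans s0).
Qed.

Lemma nonneg_poly_dilate p (s t : R) : nonneg_poly p -> 1 <= s -> 0 <= t ->
  p.[s * t] <= s ^+ size p * p.[t].
Proof.
move=> /nonneg_polyP p0 s1 t0; rewrite !horner_coef mulr_sumr.
apply: ler_sum => i _; rewrite mulrCA ler_wpM2l// exprMn ler_wpM2r ?exprn_ge0//.
by rewrite ler_weXn2l// ltnW.
Qed.

Lemma nonneg_polyC (c : R) : 0 <= c -> nonneg_poly c%:P.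
Proof. by move=> c0; apply/nonneg_polyP => i; rewrite coefC; case: ifP. Qed.

Lemma nonneg_polyX : nonneg_poly ('X : {poly R}).
Proof. by apply/nonneg_polyP => i; rewrite coefX ler0n. Qed.

Lemma nonneg_polyD p q : nonneg_poly p -> nonneg_poly q -> nonneg_poly (p + q).
Proof.
move=> /nonneg_polyP p0 /nonneg_polyP q0; apply/nonneg_polyP => i.
by rewrite coefD addr_ge0.
Qed.

Lemma nonneg_polyM p q : nonneg_poly p -> nonneg_poly q -> nonneg_poly (p * q).
Proof.
move=> /nonneg_polyP p0 /nonneg_polyP q0; apply/nonneg_polyP => i.
by rewrite coefM; apply: sumr_ge0 => j _; rewrite mulr_ge0.
Qed.

Lemma nonneg_poly_exp p n : nonneg_poly p -> nonneg_poly (p ^+ n).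
Proof.
move=> p0; elim: n => [|n IH]; first by rewrite expr0; apply: nonneg_polyC.
by rewrite exprS; apply: nonneg_polyM.
Qed.

Lemma nonneg_poly_comp p q :
  nonneg_poly p -> nonneg_poly q -> nonneg_poly (p \Po q).
Proof.
move=> /nonneg_polyP p0 q0; rewrite comp_polyE.
elim/big_rec: _ => [|i s _ s0]; first exact: nonneg_polyC.
apply: nonneg_polyD s0; rewrite -mul_polyC; apply: nonneg_polyM.
  exact: nonneg_polyC.
exact: nonneg_poly_exp.
Qed.

End NonnegPoly.

(** * Counting and limits of selections *)

Lemma size_le_at_most (R : realType) (T : choiceType) (S : set T) (b : R)
    (s : seq T) :
  at_most S b -> uniq s -> (forall x, x \in s -> S x) -> (size s)%:R <= b.
Proof.
move=> [n Sn nb] us sS; apply: le_trans nb; rewrite ler_nat.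
have fS : finite_set S by apply/finite_set_leP; exists n.
apply: leq_trans (geq_card_fset_set Sn).
apply: uniq_leq_size us _ => x /sS Sx.
by rewrite in_fset_set// inE.
Qed.

Lemma at_most_of_uniq (R : realType) (T : choiceType) (S : set T) (b : R) :
  (forall s : seq T, uniq s -> (forall x, x \in s -> S x) ->
     (size s)%:R <= b) ->
  at_most S b.
Proof.
move=> h.
have [|infS] := pselect (finite_set S); last first.
  have [B BS] := infinite_set_fset (Num.truncn b).+1 infS.
  rewrite -(ler_nat R) => /le_trans/(_ (h _ (finmap.fset_uniq B) BS)).
  by rewrite leNgt truncnS_gt.
move=> fS; have [n Sn] := fS; exists n.
  by move: Sn; rewrite card_eq_le => /andP[].
rewrite -(card_fset_set Sn); apply: h => [|x]; first exact: finmap.fset_uniq.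
by rewrite in_fset_set// inE.
Qed.

Lemma at_most_sub_seq (R : realType) (T : choiceType) (S : set T) (b : R)
    (s : seq T) :
  (forall x, S x -> x \in s) -> (size s)%:R <= b -> at_most S b.
Proof.
move=> Ss sb; apply: at_most_of_uniq => t ut tS; apply: le_trans sb.
by rewrite ler_nat uniq_leq_size// => x /tS/Ss.
Qed.

Lemma at_most_le (R : realType) (T : Type) (S S' : set T) (b b' : R) :
  S `<=` S' -> b' <= b -> at_most S' b' -> at_most S b.
Proof.
move=> SS' bb' [n Sn nb]; exists n; last exact: le_trans bb'.
exact: card_le_trans (subset_card_le SS') Sn.
Qed.

Lemma at_most_image (R : realType) (T T' : Type) (f : T -> T') (S : set T)
    (b : R) :
  at_most S b -> at_most (f @` S) b.
Proof.
move=> [n Sn nb]; exists n => //.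
exact: card_le_trans (card_image_le f S) Sn.
Qed.

Lemma at_mostU (R : realType) (T : choiceType) (S S' : set T) (b b' : R) :
  at_most S b -> at_most S' b' -> at_most (S `|` S') (b + b').
Proof.
move=> Sb S'b'; apply: at_most_of_uniq => s us sS.
rewrite -(count_predC (fun x => `[< S x >])) natrD -!size_filter.
apply: lerD.
  apply: size_le_at_most Sb _ _; first exact: filter_uniq.
  by move=> x; rewrite mem_filter => /andP[/asboolP].
apply: size_le_at_most S'b' _ _; first exact: filter_uniq.
by move=> x; rewrite mem_filter => /andP[/= /asboolP nSx /sS[]].
Qed.

Lemma at_most_union (R : realType) (T : choiceType) (J : nat)
    (S : nat -> set T) (b : R) :
  (forall j, (j < J)%N -> at_most (S j) b) ->
  at_most [set x | exists2 j, (j < J)%N & S j x] (J%:R * b).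
Proof.
elim: J => [|J IH] SJ.
  by apply: (@at_most_sub_seq _ _ _ _ [::]); [move=> x [] | rewrite mul0r].
rewrite -natr1 mulrDl mul1r.
apply: at_most_le (lexx _) (at_mostU (IH _) (SJ J (ltnSn J))) => [x [j]|j jJ].
  by rewrite ltnS leq_eqVlt => /predU1P[->|jJ] Sx; [right | left; exists j].
by apply: SJ; rewrite ltnW.
Qed.

Lemma ultra_limit_finite (I X : choiceType) (F : set_system I) (f : I -> X)
    (t : seq X) :
  UltraFilter F -> F [set i | f i \in t] -> exists y, F [set i | f i = y].
Proof.
move=> UF; elim: t => [|y t IH] Ft.
  by exfalso; have /filter_ex[] := Ft.
have [Fy|Fny] := in_ultra_setVsetC [set i | f i = y] UF; first by exists y.
apply: IH; apply: filterS (filterI Ft Fny) => i /= [].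
by rewrite inE => /predU1P[].
Qed.

(** A bound on the number of elements passes to limits: finitely many distinct
elements of the limit all occur in one of the approximating rows. *)
Lemma at_most_limit (R : realType) (I X : choiceType) (F : set_system I)
    (row : I -> set X) (S : set X) (b : R) :
  ProperFilter F -> (forall x, S x -> F [set i | row i x]) ->
  F [set i | at_most (row i) b] -> at_most S b.
Proof.
move=> FF FS Fb; apply: at_most_of_uniq => s us sS.
have Fs : F [set i | forall x, x \in s -> row i x].
  elim: s {us} sS => [|y s IH] sS; first by apply: filterE.
  have Fy : F [set i | row i y] by apply: FS; apply: sS; rewrite mem_head.
  apply: filterS (filterI Fy (IH _)) => [i [iy irest] x|x xs].
    by rewrite inE => /predU1P[->|/irest].
  by apply: sS; rewrite inE xs orbT.
have [i [ib ialls]] := filter_ex (filterI Fb Fs).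
exact: size_le_at_most ib us ialls.
Qed.

(** Compactness. Along an ultrafilter of finite sets [s], finer than the filter
of the sets containing any given elements, each value [N s a c] is eventually
constant because it ranges in the finite set [M a c]. *)
Lemma selection_limit (R : realType) (I X : choiceType) (near : I -> I -> Prop)
    (M : I -> I -> set X) (b : R) :
  (forall a c, near a c -> finite_set (M a c)) ->
  (forall s : seq I, exists n : I -> I -> X,
     (forall a c, a \in s -> c \in s -> near a c -> M a c (n a c)) /\
     forall a, a \in s ->
       at_most [set n a c | c in [set c | c \in s /\ near a c]] b /\
       at_most [set n c a | c in [set c | c \in s /\ near c a]] b) ->
  exists n : I -> I -> X,
    (forall a c, near a c -> M a c (n a c)) /\
    forall a, at_most [set n a c | c in [set c | near a c]] b /\
       at_most [set n c a | c in [set c | near c a]] b.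
Proof.
move=> Mfin /choice[N hN].
pose above (t : seq I) := [set s : seq I | {subset t <= s}].
have aboveF : ProperFilter (filter_from [set: seq I] above).
  apply: filter_from_proper => [|t _]; last by exists t.
  apply: filter_from_filter; first by exists [::].
  by move=> t t' _ _; exists (t ++ t') => // s ts; split=> x xt; apply: ts;
    rewrite mem_cat xt ?orbT.
have [F [UF aboveS]] := ultraFilterLemma aboveF.
have Fin (a : I) : F [set s : seq I | a \in s].
  by apply: aboveS; exists [:: a] => // s; apply; rewrite mem_head.
have lim a c : exists y, near a c -> F [set s | N s a c = y].
  have [nac|] := pselect (near a c); last first.
    by move=> nn; exists (N [::] a c).
  have /finite_seqP[t Mt] := Mfin a c nac.
  have [|y Fy] := @ultra_limit_finite _ _ F (fun s => N s a c) t UF.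
    apply: filterS (filterI (Fin a) (Fin c)) => s [sa sc] /=.
    have := (hN s).1 a c sa sc nac; by rewrite Mt.
  by exists y.
have [n hn] : exists n : I -> I -> X,
    forall a c, near a c -> F [set s | N s a c = n a c].
  by exists (fun a c => sval (cid (lim a c))) => a c; case: (cid (lim a c)).
exists n; split=> [a c nac|a].
  have [s [[sa sc] Ns]] :=
    filter_ex (filterI (filterI (Fin a) (Fin c)) (hn a c nac)).
  by have /= <- := Ns; apply: (hN s).1.
split.
  apply: (@at_most_limit _ _ _ F
    (fun s => [set N s a c | c in [set c | c \in s /\ near a c]]))
    => [_ [c nac <-]|].
    apply: filterS (filterI (Fin c) (hn a c nac)) => s [sc Ns].
    by exists c.
  by apply: filterS (Fin a) => s sa; have [] := (hN s).2 a sa.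
apply: (@at_most_limit _ _ _ F
    (fun s => [set N s c a | c in [set c | c \in s /\ near c a]]))
    => [_ [c nca <-]|].
  apply: filterS (filterI (Fin c) (hn c a nca)) => s [sc Ns].
  by exists c.
by apply: filterS (Fin a) => s sa; have [] := (hN s).2 a sa.
Qed.

(** * Selections in a space with a CR map *)

Section CoarseCR.
Context (R : realType) (X : metricType R) (C : X -> X -> set X).
Context (p q : {poly R}).
Hypothesis p_nneg : nonneg_poly p.
Hypothesis q_nneg : nonneg_poly q.
Hypothesis C_self : forall x y, C x y x.
Hypothesis C_centre : forall x y z, C x y `&` C y z `&` C z x !=set0.
Hypothesis C_count : forall x y (r : R), 0 <= r ->
  at_most (C x y `&` mcball x r) p.[r].
Hypothesis C_diam : forall x y (r : R), mdist x y <= r -> diam_le (C x y) q.[r].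

Let V : {poly R} := p \Po q.
(** [h (2^i r)] is the radius at the [i]-th step: [q] accounts for the distance
from the end of a walk of length [2^i] to its centroid, and twice [2^i r] for
the walk itself and for the distance between its ends. *)
Let h : {poly R} := q + 2%:P * 'X.
Let U : {poly R} := V \Po h + 1%:P.
(** The factor by which [U] grows at most when its argument is doubled. *)
Let D : R := 2 ^+ size U.

(** This is [16 m^2 / theta^2] for [m = 2 U] and [theta = 1 / (2 G)], where [G
= 2 U (U D^2)^2] is the norm bound. *)
Definition selection_bound : {poly R} := (2 ^+ 10 * D ^+ 8)%:P * U ^+ 8.

(** Since [C x y] has diameter at most [q t] and contains [x], it is the part
of itself in a ball about [x], so that a count in balls becomes a total count.
*)
Lemma C_at_most x y t : mdist x y <= t -> at_most (C x y) V.[t].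
Proof.
move=> xyt; have t0 : 0 <= t := le_trans (mdist_ge0 _ _) xyt.
have qt0 := nonneg_poly_ge0 q_nneg t0.
rewrite horner_comp; apply: at_most_le (C_count x y qt0) => // z Cz; split=> //.
exact: C_diam xyt _ _ (C_self x y) Cz.
Qed.

Let V_nneg : nonneg_poly V. Proof. exact: nonneg_poly_comp. Qed.

Let h_nneg : nonneg_poly h.
Proof.
apply: nonneg_polyD => //; apply: nonneg_polyM; last exact: nonneg_polyX.
exact: nonneg_polyC.
Qed.

Let U_nneg : nonneg_poly U.
Proof.
by apply: nonneg_polyD; [exact: nonneg_poly_comp | exact: nonneg_polyC].
Qed.

Let D_ge1 : 1 <= D. Proof. by rewrite exprn_ege1// ler1n. Qed.

Lemma selection_bound_nneg : nonneg_poly selection_bound.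
Proof.
apply: nonneg_polyM; last exact: nonneg_poly_exp.
by apply: nonneg_polyC; rewrite mulr_ge0 ?exprn_ge0 ?(le_trans _ D_ge1).
Qed.

Let hE t : h.[t] = q.[t] + 2 * t.
Proof. by rewrite hornerD hornerM hornerC hornerX. Qed.

Let UE t : U.[t] = V.[h.[t]] + 1.
Proof. by rewrite hornerD hornerC horner_comp. Qed.

Let U_ge1 t : 0 <= t -> 1 <= U.[t].
Proof. by move=> t0; rewrite UE lerDr nonneg_poly_ge0// nonneg_poly_ge0. Qed.

Let V_le_U t : 0 <= t -> V.[t] <= U.[t].
Proof.
move=> t0; rewrite UE; apply: ler_wpDr => //; apply: nonneg_poly_mono => //.
by rewrite hE; have := nonneg_poly_ge0 q_nneg t0; lra.
Qed.

(** The dual weights of [fractional_selection] are excluded by [form_le_global]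
applied to the constant vector [1]. *)
Lemma finite_selection (A : finType) (e : A -> X) (r : R) : 1 <= r ->
  exists n : A -> A -> X,
    (forall a b, mdist (e a) (e b) <= r ->
       C (e a) (e b) (n a b) \/ C (e b) (e a) (n a b)) /\
    forall a, exists2 F : seq X, (size F)%:R <= selection_bound.[r] &
      forall b, mdist (e a) (e b) <= r -> n a b \in F /\ n b a \in F.
Proof.
move=> r1; have r0 : 0 <= r := le_trans ler01 r1.
pose S := \bigcup_(a in [set: A]) \bigcup_(b in [set: A]) C (e a) (e b).
have /finite_seqP[s Ss] : finite_set S.
  apply: bigcup_finite => // a _; apply: bigcup_finite => // b _.
  have [k Ck _] := C_at_most (lexx (mdist (e a) (e b))).
  by apply/finite_set_leP; exists k.
pose Y : finType := seq_sub s.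
pose f (j : Y) : X := val j.
have f_inj : injective f by exact: val_inj.
have f_onto a b y : C (e a) (e b) y -> exists j, f j = y.
  move=> Cy; have yS : [set` s] y by rewrite -Ss; exists a => //; exists b.
  by exists (SeqSub yS).
have C_card x y t : mdist x y <= t ->
    #|[pred j | `[< C x y (f j) >]]|%:R <= V.[t].
  move=> xyt; rewrite -(size_image f).
  apply: size_le_at_most (C_at_most xyt) _ _.
    by rewrite map_inj_uniq ?enum_uniq.
  by move=> z /mapP[j]; rewrite mem_enum inE => Cj ->.
have C_tri a b z : exists j,
    [/\ C (e a) z (f j), C z (e b) (f j) & C (e b) (e a) (f j)].
  have [y [[Caz Czb] Cba]] := C_centre (e a) z (e b).
  by have [j fj] := f_onto _ _ _ Cba; exists j; rewrite fj.
pose Q (t : R) := q.[t].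
have C_reach x y z t : mdist x y <= t -> C x y z -> mdist x z <= Q t.
  by move=> xyt Cz; exact: C_diam xyt _ _ (C_self x y) Cz.
pose E a b := mdist (e a) (e b) <= r.
have E_sym : symmetric E by move=> a b; rewrite /E metric_sym.
pose M a b j := on_interval f C (e a) (e b) j || on_interval f C (e b) (e a) j.
have M_sym a b j : M a b j = M b a j by rewrite /M orbC.
have Ur := U_ge1 r0.
have Ur0 : 0 < U.[r] by apply: lt_le_trans Ur.
have D0 : 0 < D by apply: lt_le_trans D_ge1.
pose K := U.[r] * D.
have K1 : 1 <= K by rewrite mulr_ege1.
pose G := 2 * U.[r] * (K * D) ^+ 2.
have G1 : 1 <= G.
  have UKD : 1 <= U.[r] * (K * D) ^+ 2.
    by rewrite mulr_ege1// exprn_ege1// mulr_ege1.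
  by rewrite /G -mulrA; lra.
have G0 : 0 < G by apply: lt_le_trans G1.
pose theta := (2 * G)^-1.
have th0 : 0 < theta by rewrite invr_gt0 mulr_gt0.
have th2 : theta <= 2.
  by rewrite /theta invf_ple ?posrE ?mulr_gt0//; lra.
have thG : theta * G < 1.
  by rewrite /theta invfM mulfVK ?gt_eqF// invf_lt1// ltr1n.
have no_dual (w : A -> R) (T : A -> A -> R) :
     (forall a, 0 < w a) -> kernel_ge0 T -> kernel_sym T ->
     (forall a b, T a b != 0 -> E a b) ->
     (forall j v, (forall a, 0 <= v a) ->
        form (masked M T j) v v <= ip w v v) ->
     \sum_a \sum_b T a b <= G * \sum_a w a.
  move=> w0 T0 Ts TE maskedT.
  pose N i : R := h.[2 ^+ i * r].
  have s0 i : 0 <= 2 ^+ i * r by rewrite mulr_ge0// exprn_ge0.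
  have N0 i : 0 <= N i by rewrite /N nonneg_poly_ge0.
  have QN i : Q ((2 ^ i)%:R * r) + (2 ^ i)%:R * r + (2 ^ i)%:R * r <= N i.
    by rewrite natrX /N hE /Q; lra.
  have VN i : V.[N i.+1] <= K * D ^+ i.
    apply: le_trans (_ : U.[2 ^+ i.+1 * r] <= _); first by rewrite UE lerDl.
    apply: le_trans (nonneg_poly_dilate U_nneg (exprn_ege1 _ _) r0) _.
      by rewrite ler1n.
    by rewrite exprAC -/D exprS /K; lra.
  have N_unb x : exists i, x <= N i.
    exists (Num.truncn x).+1; set i := _.+1; rewrite /N hE.
    have xi : x <= i%:R by rewrite ltW// truncnS_gt.
    have i2 : i%:R <= 2 ^+ i :> R by rewrite -natrX ler_nat ltnW// ltn_expl.
    have q0 : 0 <= q.[2 ^+ i * r] by rewrite nonneg_poly_ge0.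
    have : 2 ^+ i * 1 <= 2 ^+ i * r by rewrite ler_wpM2l// exprn_ge0.
    have := s0 i; lra.
  have loc0 : local_bound e w T (N 0%N) (2 * U.[r]).
    move=> z u u0.
    apply: le_trans
      (local_bound_base w0 T0 C_card C_tri (N0 0%N) maskedT z u0) _.
    rewrite ler_wpM2r ?ip_ge0// ler_pM2l//.
    by rewrite /N expr0 mul1r UE lerDl.
  have U20 : 0 < 2 * U.[r] by rewrite mulr_gt0.
  have := form_le_global w0 T0 Ts TE r0 C_reach C_card C_tri U20 K1 D_ge1 N0 QN
    VN N_unb loc0 (fun _ => ler01).
  rewrite /form /ip; under eq_bigr do under eq_bigr do rewrite mul1r mulr1.
  by under [in X in _ <= _ * X]eq_bigr do rewrite mul1r mulr1.
have th02 : 0 < theta <= 2 by rewrite th0.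
have [a [a0 a2 aM]] := fractional_selection E_sym M_sym th02 thG no_dual.
pose m := 2 * U.[r].
have m0 : 0 < m by rewrite mulr_gt0.
have Mm x y : E x y -> #|M x y|%:R <= m.
  move=> Exy; have Eyx : mdist (e y) (e x) <= r by rewrite metric_sym.
  have c1 := C_card _ _ _ Exy; have c2 := C_card _ _ _ Eyx.
  have VU := V_le_U r0.
  apply: le_trans (_ : #|[pred j | `[< C (e x) (e y) (f j) >]]|%:R +
    #|[pred j | `[< C (e y) (e x) (f j) >]]|%:R <= _); last by rewrite /m; lra.
  rewrite -natrD ler_nat -cardUI; apply: leq_trans (leq_addr _ _).
  by apply: subset_leq_card; apply/fintype.subsetP => j; rewrite !inE.
have [F [Fcard Fsel]] := selection_of_fractional th0 m0 a0 a2 aM Mm.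
have sel x y : exists z, E x y ->
    exists j, [/\ z = f j, M x y j, F x j & F y j].
  have [Exy|_] := boolP (E x y); last by exists (e x).
  by have [j [Mj Fx Fy]] := Fsel x y Exy; exists (f j) => _; exists j.
have [n hn] : exists n : A -> A -> X, forall x y, E x y ->
    exists j, [/\ n x y = f j, M x y j, F x j & F y j].
  by exists (fun x y => sval (cid (sel x y))) => x y; case: (cid (sel x y)).
exists n; split=> [x y Exy|x].
  have [j [-> + _ _]] := hn _ _ Exy.
  by rewrite /M => /orP[] /asboolP; [left|right].
exists [seq f j | j in F x] => [|y Exy].
  rewrite size_image; apply: le_trans (Fcard x) _.
  rewrite /selection_bound hornerM hornerC horner_exp /theta /m /G /K.
  rewrite exprVn invrK le_eqVlt; apply/orP; left; apply/eqP; ring.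
have Eyx : E y x by rewrite E_sym.
have [j [-> _ Fj _]] := hn _ _ Exy; have [j' [-> _ _ Fj']] := hn _ _ Eyx.
by split; apply: fintype.image_f.
Qed.


Lemma infinite_selection (I : choiceType) (e : I -> X) (r : R) : 1 <= r ->
  exists n : I -> I -> X,
    (forall a b, mdist (e a) (e b) <= r ->
       (C (e a) (e b) `|` C (e b) (e a)) (n a b)) /\
    forall a,
      at_most [set n a b | b in [set b | mdist (e a) (e b) <= r]]
        selection_bound.[r] /\
      at_most [set n b a | b in [set b | mdist (e b) (e a) <= r]]
        selection_bound.[r].
Proof.
move=> r1.
apply: (@selection_limit _ _ _ (fun a b => mdist (e a) (e b) <= r)
  (fun a b => C (e a) (e b) `|` C (e b) (e a))) => [a b _|s].
  rewrite finite_setU; split; apply/finite_set_leP.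
    by have [k Ck _] := C_at_most (lexx (mdist (e a) (e b))); exists k.
  by have [k Ck _] := C_at_most (lexx (mdist (e b) (e a))); exists k.
have [n [nC nF]] := finite_selection (fun a : seq_sub s => e (ssval a)) r1.
pose n' a b := if insub a is Some a' then
  if insub b is Some b' then n a' b' else e a else e a.
have n'E (a b : seq_sub s) : n' (ssval a) (ssval b) = n a b.
  by rewrite /n' !valK.
exists n'; split=> [a b sa sb near|a sa].
  by rewrite -[a]/(ssval (SeqSub sa)) -[b]/(ssval (SeqSub sb)) n'E; apply: nC.
have [E Eb nE] := nF (SeqSub sa).
split; apply: at_most_sub_seq Eb => _ [b [sb near] <-].
  rewrite -[a]/(ssval (SeqSub sa)) -[b]/(ssval (SeqSub sb)) n'E.
  by have [] := nE (SeqSub sb) near.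
rewrite -[a]/(ssval (SeqSub sa)) -[b]/(ssval (SeqSub sb)) n'E.
by have [|] := nE (SeqSub sb); first by rewrite metric_sym.
Qed.

(** The pair [(a,b)] uses the selection at the scale given by the integral part
of its distance; a ball of radius [r] meets at most [r + 1] scales. *)
Lemma multiscale_selection (I : choiceType) (e : I -> X) :
  exists n : I -> I -> X,
    (forall a b, (C (e a) (e b) `|` C (e b) (e a)) (n a b)) /\
    forall a r, 0 <= r ->
      at_most [set n a b | b in [set b | mdist (e a) (e b) <= r]]
        ((r + 1) * selection_bound.[r + 1]) /\
      at_most [set n b a | b in [set b | mdist (e b) (e a) <= r]]
        ((r + 1) * selection_bound.[r + 1]).
Proof.
have scale_ge1 j : 1 <= j.+1%:R :> R by rewrite ler1n.
have /choice[N hN] := fun j => infinite_selection e (scale_ge1 j).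
pose lev a b := Num.truncn (mdist (e a) (e b)).
have lev_le a b : mdist (e a) (e b) <= (lev a b).+1%:R.
  by rewrite ltW ?truncnS_gt.
exists (fun a b => N (lev a b) a b).
split=> [a b|a r r0]; first exact: (hN _).1.
have sel_le j : (j < (Num.truncn r).+1)%N ->
    selection_bound.[j.+1%:R] <= selection_bound.[r + 1].
  move=> jr; apply: nonneg_poly_mono selection_bound_nneg _ _ => //.
  rewrite -natr1 lerD2r.
  apply: (le_trans (y := (Num.truncn r)%:R)); last by rewrite truncn_le.
  by rewrite ler_nat -ltnS.
have lev_lt a' b : mdist (e a') (e b) <= r -> (lev a' b < (Num.truncn r).+1)%N.
  by move=> near; rewrite ltnS; apply: le_truncn.
have tr : (Num.truncn r).+1%:R * selection_bound.[r + 1] <=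
    (r + 1) * selection_bound.[r + 1].
  rewrite ler_wpM2r ?nonneg_poly_ge0 ?addr_ge0//.
    exact: selection_bound_nneg.
  by rewrite -natr1 lerD2r truncn_le.
split.
  apply: at_most_le tr (at_most_union (S := fun j =>
    [set N j a b | b in [set b | mdist (e a) (e b) <= j.+1%:R]]) _).
    move=> _ [b near <-]; exists (lev a b); first exact: lev_lt.
    by exists b => //; exact: lev_le.
  by move=> j jr; apply: at_most_le (sel_le j jr) ((hN j).2 a).1.
apply: at_most_le tr (at_most_union (S := fun j =>
  [set N j b a | b in [set b | mdist (e b) (e a) <= j.+1%:R]]) _).
  move=> _ [b near <-]; exists (lev b a); first exact: lev_lt.
  by exists b => //; exact: lev_le.
by move=> j jr; apply: at_most_le (sel_le j jr) ((hN j).2 a).2.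
Qed.

End CoarseCR.

(** * The centroid property *)

Theorem theorem3p4 (R : realType) (G : groupType) :
  countable [set: G] -> CR_property R G -> centroid_property R G.
Proof.
move=> _ [X [act [C [[[x0 _] actP free equiv] [C_self C_centre
  [p p_nneg C_count] [q q_nneg C_diam]]]]]].
have [act1 actM act_iso] := actP.
pose e (g : G) := act g x0.
have e_iso k g h : mdist (e (k * g)%g) (e (k * h)%g) = mdist (e g) (e h).
  by rewrite /e !actM act_iso.
have [n [nC nrow]] := multiscale_selection p_nneg q_nneg C_self C_centre C_count
  C_diam e.
(* The translation by [k] moves the selected point back to an interval between
   [x0] and [g x0]; for fixed [k] the values lie in the row of [n] at
   [k^-1], for fixed [h] in its column at [h^-1]. *)
pose c (g k : G) := act k (n k^-1%g (k^-1 * g)%g).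
pose B := selection_bound p q.
pose V := p \Po q.
pose P := ('X + 1%:P) * (B \Po ('X + 1%:P)) + 2%:P * V.
have PE t : P.[t] = (t + 1) * B.[t + 1] + 2 * V.[t].
  by rewrite !(hornerD, hornerM, horner_comp, hornerC, hornerX).
have B_nneg : nonneg_poly B by exact: selection_bound_nneg.
have V_nneg : nonneg_poly V by exact: nonneg_poly_comp.
have X1_nneg : nonneg_poly ('X + 1%:P : {poly R}).
  by apply: nonneg_polyD; [exact: nonneg_polyX | exact: nonneg_polyC].
exists X, act, x0, c, P => L.
have LE k g : mdist (e k) (e (k * g)%g) = L g.
  by rewrite -{1}[k]mulg1 e_iso /e act1.
have P_row r : 0 <= r -> (r + 1) * B.[r + 1] <= P.[r].
  by move=> r0; rewrite PE lerDl mulr_ge0// nonneg_poly_ge0.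
split; split=> //.
- exists 1%N => x; rewrite free.
  by have := @card_set1 G 1%g; rewrite card_eq_le => /andP[].
- apply: nonneg_polyD; apply: nonneg_polyM => //; last exact: nonneg_polyC.
  exact: nonneg_poly_comp.
- move=> k r r0.
  apply: at_most_le (P_row r (ltW r0))
    (at_most_image (act k) (nrow k^-1%g r (ltW r0)).1).
  move=> _ [g gr <-]; exists (n k^-1%g (k^-1 * g)%g) => //.
  by exists (k^-1 * g)%g => //=; rewrite LE.
- move=> g.
  have Lg0 : 0 <= L g by apply: mdist_ge0.
  have C1 := C_at_most q_nneg C_self C_count C_diam (lexx (mdist x0 (e g))).
  have C2 : at_most (C (e g) x0) V.[L g].
    by apply: C_at_most => //; rewrite metric_sym.
  apply: at_most_le (at_mostU C1 C2).
    move=> _ [k _ <-]; have := nC k^-1%g (k^-1 * g)%g.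
    have kx : act k (e k^-1%g) = x0 by rewrite /e -actM mulgV act1.
    have kg : act k (e (k^-1 * g)%g) = e g by rewrite /e -actM mulVKg.
    have C_act x y z : C x y z -> C (act k x) (act k y) (act k z).
      by move=> Cz; rewrite equiv; exists z.
    by case=> /C_act; rewrite kx kg; [left | right].
  rewrite PE -/V -/(L g).
  have B0 : 0 <= B.[L g + 1] by rewrite nonneg_poly_ge0// addr_ge0.
  have : 0 <= (L g + 1) * B.[L g + 1] by rewrite mulr_ge0// addr_ge0.
  lra.
- move=> h r r0.
  apply: at_most_le (P_row r (ltW r0))
    (at_most_image (act h) (nrow h^-1%g r (ltW r0)).2).
  move=> _ [g gr <-]; exists (n (h^-1 * g^-1)%g h^-1%g).
    exists (h^-1 * g^-1)%g => //=.
    rewrite metric_sym LE /L /orbit_length metric_sym -(act_iso g) -actM.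
    by rewrite mulgV act1.
  rewrite /c invgM -mulgA mulVg mulg1 -actM; congr (act _ _).
  by rewrite mulKg.
Qed.
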